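(* Let $(\alpha^e,\mathbf{0}_g)$ be an equilibrium point of the power network described in the context, with angle vector $\theta^e=((\alpha^e)^T,0)^T$, active power flow graph $\mathcal{G}(\mathcal{V},\mathcal{E},\mathbf{W}(\theta^e))$ and Laplacian $L(\theta^e)$, all edge weights being nonzero. Let $\mathcal{V}_-$ be the set of nodes incident to at least one edge of negative weight. The following statements are equivalent: (a) The equilibrium point is hyperbolic and locally asymptotically stable. (b) There exists a sequential inclusion $\{\mathcal{V}_-^k\}$ of $\mathcal{V}_-$ such that $g_{\mathrm{eff}}(L(\theta^e),\mathcal{V}_-^{k+1}\setminus\mathcal{V}_-^k,\mathcal{V}_-^k)>0$ for $k=1,2,\dots,|\mathcal{V}_-|-1$. (c) $g_{\mathrm{eff}}(L(\theta^e),\mathcal{V}_a,\mathcal{V}_b)>0$ for any two non-empty disjoint sets $\mathcal{V}_a,\mathcal{V}_b\subset\mathcal{V}$.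
   Context: Power network: a connected simple undirected graph with buses $\mathcal{V}=\{1,\dots,n\}$ and lines $\mathcal{E}$ ($l=|\mathcal{E}|$); $\mathcal{V}_G=\{1,\dots,g\}$ (generator internal buses), $\mathcal{V}_L=\{g+1,\dots,n\}$, $d=n-g$; constants $V_i>0$, $B_{ij}=B_{ji}>0$ for each line (purely inductive lines), $M_i>0$ for $i\in\mathcal{V}_G$, $D_i>0$ for all $i$, and $P_i\in\mathbb{R}$ with $\sum_iP_i=0$. With $\mathcal{N}_i$ the neighbours of $i$ and $\theta_{ij}=\theta_i-\theta_j$, the dynamics are $$M_i\ddot\theta_i+D_i\dot\theta_i=P_i-\sum_{j\in\mathcal{N}_i}V_iV_jB_{ij}\sin\theta_{ij}\ (i\in\mathcal{V}_G),\qquad D_i\dot\theta_i=P_i-\sum_{j\in\mathcal{N}_i}V_iV_jB_{ij}\sin\theta_{ij}\ (i\in\mathcal{V}_L).$$ Let $T=[\,I_{n-1}\ \ -\mathbf{1}_{n-1}\,]\in\mathbb{R}^{(n-1)\times n}$, $T_G,T_L$ its submatrices of columns indexed by $\mathcal{V}_G,\mathcal{V}_L$; states are $\alpha=T\theta$ and $\omega_G=\dot\theta_G$. An equilibrium point is $(\alpha^e,\mathbf{0}_g)$ such that $\theta^e=((\alpha^e)^T,0)^T$ satisfies $P_i=\sum_{j\in\mathcal{N}_i}V_iV_jB_{ij}\sin\theta^e_{ij}$ for all $i$. Active power flow graph $\mathcal{G}(\mathcal{V},\mathcal{E},\mathbf{W}(\theta))$: edge weights $w_{ij}=V_iV_jB_{ij}\cos\theta_{ij}$,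 forming the diagonal matrix $\mathbf{W}(\theta)\in\mathbb{R}^{l\times l}$; $L(\theta)=\mathbf{E}\mathbf{W}(\theta)\mathbf{E}^T$, with $\mathbf{E}$ the incidence matrix for an arbitrary orientation (column of an edge from $i$ to $j$: $1$ in row $i$, $-1$ in row $j$, $0$ elsewhere). $F(\theta)$ is $L(\theta)$ with last row and column deleted. With $M=\mathrm{diag}(M_i)_{i\in\mathcal{V}_G}$, $D_G=\mathrm{diag}(D_i)_{i\in\mathcal{V}_G}$, $D_L=\mathrm{diag}(D_i)_{i\in\mathcal{V}_L}$, the linearization matrix at the equilibrium is $$J_{dyn}(\theta^e)=\begin{bmatrix}-T_LD_L^{-1}T_L^TF(\theta^e)&T_G\\-M^{-1}T_G^TF(\theta^e)&-M^{-1}D_G\end{bmatrix}.$$ Let $i_+(\cdot),i_0(\cdot)$ denote the number of eigenvalues with positive, respectively zero, real part. The equilibrium is hyperbolic if $i_0(J_{dyn}(\theta^e))=0$; a hyperbolic equilibrium is called locally asymptotically stable if $i_+(J_{dyn}(\theta^e))=0$. Effective conductance: for a Laplacian $L$ and non-empty disjoint $\mathcal{V}_a,\mathcal{V}_b\subset\mathcal{V}$ put $\mathcal{V}_c=\mathcal{V}\setminus(\mathcal{V}_a\cup\mathcal{V}_b)$, and let $L_{xy}$ be the submatrix of $L$ with rows indexed by $\mathcal{V}_x$ and columns by $\mathcal{V}_y$. If $L_{cc}$ is nonsingular, let $$L/L_{cc}=\begin{bmatrix}L_{aa}&L_{ab}\\L_{ab}^T&L_{bb}\end{bmatrix}-\begin{bmatrix}L_{ac}\\L_{bc}\end{bmatrix}L_{cc}^{-1}\begin{bmatrix}L_{ac}^T&L_{bc}^T\end{bmatrix}$$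 ($=L$ if $\mathcal{V}_c=\emptyset$), and $g_{\mathrm{eff}}(L,\mathcal{V}_a,\mathcal{V}_b)=\mathbf{e}_{\mathcal{V}_a}^T(L/L_{cc})\mathbf{e}_{\mathcal{V}_a}$, where $\mathbf{e}_{\mathcal{V}_a}\in\mathbb{R}^{|\mathcal{V}_a|+|\mathcal{V}_b|}$ has entries $1$ on $\mathcal{V}_a$, $0$ on $\mathcal{V}_b$. ''$g_{\mathrm{eff}}(\cdot)>0$'' means that the corresponding $L_{cc}$ is nonsingular and the value is positive. Sequential inclusion of a set $\mathcal{U}$ with $|\mathcal{U}|=m$: subsets $\mathcal{U}^1\subset\mathcal{U}^2\subset\dots\subset\mathcal{U}^m=\mathcal{U}$ with $|\mathcal{U}^{k+1}|-|\mathcal{U}^k|=1$, $k=1,\dots,m-1$. If $\mathcal{V}_-=\emptyset$, (b) is regarded as vacuously true. *)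

(* Defs.v *)
From HB Require Import structures.
From mathcomp Require Import all_boot all_order all_algebra.
From mathcomp Require Import all_classical all_reals all_analysis.
From mathcomp Require Import complex.

Set Implicit Arguments.
Unset Strict Implicit.
Unset Printing Implicit Defensive.

Import Order.TTheory GRing.Theory Num.Theory.
Local Open Scope ring_scope.

(* The buses are 'I_(g + d), numbered from 0: the generator buses are the
   lshift d i (i : 'I_g), the load buses the rshift g i (i : 'I_d), and the
   last bus is the one of value (g + d).-1. The values of B off the lines are
   never used. The dynamics described by these data are
     M_i theta_i'' + D_i theta_i' = P_i - \sum_(j | i ~ j) V_i V_j B_ij sin (theta_i - theta_j)
   at generator buses, and the same with M_i = 0 at load buses. *)
Record power_network (R : realType) (g d : nat) := PowerNetwork {
  line : rel 'I_(g + d);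
  volt : 'I_(g + d) -> R;
  susc : 'I_(g + d) -> 'I_(g + d) -> R;
  inertia : 'I_g -> R;
  damping : 'I_(g + d) -> R;
  power : 'I_(g + d) -> R;
  bus_nonempty : (0 < g + d)%N;
  line_sym : symmetric line;
  line_irr : irreflexive line;
  line_connected : forall i j, connect line i j;
  volt_gt0 : forall i, 0 < volt i;
  susc_sym : forall i j, line i j -> susc i j = susc j i;
  susc_gt0 : forall i j, line i j -> 0 < susc i j;
  inertia_gt0 : forall i, 0 < inertia i;
  damping_gt0 : forall i, 0 < damping i;
  power_balance : \sum_i power i = 0
}.

(* An orientation is the set of oriented lines (tail, head): it contains
   exactly one of (i, j) and (j, i) for every line. *)
Definition is_orientation (n : nat) (e : rel 'I_n) (O : {set 'I_n * 'I_n}) :=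
  (forall i j, (i, j) \in O -> e i j) /\
  (forall i j, e i j -> ((i, j) \in O) (+) ((j, i) \in O)).

Definition incidence (R : realType) (n : nat) (O : {set 'I_n * 'I_n}) :
    'M[R]_(n, #|O|) :=
  \matrix_(i, k) ((i == (enum_val k).1)%:R - (i == (enum_val k).2)%:R).

Section EffectiveConductance.
Variables (R : realType) (n : nat) (L : 'M[R]_n).

(* The rows and columns are listed in the order of enum_val. *)
Definition submx_set (A B : {set 'I_n}) : 'M[R]_(#|A|, #|B|) :=
  \matrix_(i, j) L (enum_val i) (enum_val j).

(* When C is empty, the subtracted term is a product through dimension 0,
   hence 0, and the empty matrix submx_set C C is invertible. *)
Definition schur_compl (A B : {set 'I_n}) : 'M[R]_(#|A| + #|B|) :=
  let C := (~: (A :|: B))%SET in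
  block_mx (submx_set A A) (submx_set A B)
           (submx_set A B)^T (submx_set B B)
  - col_mx (submx_set A C) (submx_set B C)
    *m invmx (submx_set C C)
    *m row_mx (submx_set A C)^T (submx_set B C)^T.

Definition geff (A B : {set 'I_n}) : R :=
  let e : 'cV[R]_(#|A| + #|B|) := col_mx (const_mx 1) (const_mx 0) in
  (e^T *m schur_compl A B *m e) ord0 ord0.

Definition geff_gt0 (A B : {set 'I_n}) : Prop :=
  let C := (~: (A :|: B))%SET in
  submx_set C C \in unitmx /\ 0 < geff A B.

End EffectiveConductance.

Section Eigenvalues.
Variables (R : realType) (m : nat).
Implicit Type A : 'M[R]_m.

(* Listed with algebraic multiplicity. *)
Definition eigenvalues A : seq R[i] :=
  sval (closed_field_poly_normal (char_poly (map_mx (real_complex R) A))).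

Definition i_plus A : nat :=
  count (fun z : R[i] => 0 < complex.Re z) (eigenvalues A).

Definition i_zero A : nat :=
  count (fun z : R[i] => complex.Re z == 0) (eigenvalues A).

End Eigenvalues.

Section Network.
Variables (R : realType) (g d : nat) (N : power_network R g d).

Local Notation n := (g + d)%N.

Definition T_mx : 'M[R]_(n.-1, n) :=
  \matrix_(i, j) if j == n.-1 :> nat then -1 else (i == j :> nat)%:R.

Definition T_G : 'M[R]_(n.-1, g) := lsubmx T_mx.
Definition T_L : 'M[R]_(n.-1, d) := rsubmx T_mx.

Definition M_mx : 'M[R]_g := diag_mx (\row_i inertia N i).
Definition D_G : 'M[R]_g := diag_mx (\row_i damping N (lshift d i)).
Definition D_L : 'M[R]_d := diag_mx (\row_i damping N (rshift g i)).

(* theta = (alpha^T, 0)^T *)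
Definition angle_of (alpha : 'cV[R]_n.-1) : 'cV[R]_n :=
  \col_j if insub (val j) is Some i then alpha i ord0 else 0.

Definition power_flow (theta : 'cV[R]_n) (i : 'I_n) : R :=
  \sum_(j | line N i j)
    volt N i * volt N j * susc N i j * sin (theta i ord0 - theta j ord0).

Definition is_equilibrium (alpha : 'cV[R]_n.-1) (omegaG : 'cV[R]_g) : Prop :=
  omegaG = 0 /\ forall i, power N i = power_flow (angle_of alpha) i.

Section AtAngle.
Variables (O : {set 'I_n * 'I_n}) (theta : 'cV[R]_n).

Definition weight (i j : 'I_n) : R :=
  volt N i * volt N j * susc N i j * cos (theta i ord0 - theta j ord0).

Definition weight_mx : 'M[R]_#|O| :=
  diag_mx (\row_k weight (enum_val k).1 (enum_val k).2).

Definition laplacian : 'M[R]_n :=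
  incidence R O *m weight_mx *m (incidence R O)^T.

Definition F_mx : 'M[R]_n.-1 :=
  mxsub (widen_ord (leq_pred n)) (widen_ord (leq_pred n)) laplacian.

Definition J_dyn : 'M[R]_(n.-1 + g) :=
  block_mx (- (T_L *m invmx D_L *m T_L^T *m F_mx)) T_G
           (- (invmx M_mx *m T_G^T *m F_mx)) (- (invmx M_mx *m D_G)).

Definition hyperbolic : Prop := i_zero J_dyn = 0%N.

(* Meant for hyperbolic equilibria. *)
Definition locally_asymptotically_stable : Prop := i_plus J_dyn = 0%N.

Definition neg_nodes : {set 'I_n} :=
  [set i | [exists j, line N i j && (weight i j < 0)]].

End AtAngle.
End Network.

(* Only the values U 1, ..., U #|S| matter; U 1 is a singleton when S is
   non-empty. *)
Definition sequential_inclusion (T : finType) (S : {set T}) (U : nat -> {set T})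
    : Prop :=
  (forall k, (1 <= k < #|S|)%N ->
     U k \subset U k.+1 /\ #|U k.+1| = #|U k|.+1) /\
  U #|S| = S.

(* Main.v *)
Require Import Defs.
From HB Require Import structures.
From mathcomp Require Import all_boot all_order all_algebra.
From mathcomp Require Import all_classical all_reals all_analysis.
From mathcomp Require Import complex.
From mathcomp Require Import ring lra.

Set Implicit Arguments.
Unset Strict Implicit.
Unset Printing Implicit Defensive.

Import Order.TTheory GRing.Theory Num.Theory.
Local Open Scope ring_scope.

(** All three statements say that the Laplacian L has x^T L x > 0 for every x that is
    not constant ([pos_nonconst]), that is, that L grounded at the last bus, the matrix
    F, is positive definite ([posdef_F_mx]).

    Stability. If F is positive definite, x^T F x + y^T M y is an energy dissipated by
    the linearized dynamics, and no eigenvalue can have a real part >= 0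
    ([posdef_stable]). If F is not positive definite, either it is singular and 0 is an
    eigenvalue, or its form takes a negative value. In the second case consider the
    symmetric pencil t^2 M + t D + L, with M extended by 0 to the load buses: not
    semidefinite at t = 0 and positive definite for large t, it is singular for some
    t > 0 ([singular_pencil]), and a kernel vector there yields an eigenvector of the
    linearization with eigenvalue t ([not_posdef_unstable]).

    Effective conductance. geff L A B is z^T L z for the potential z which is 1 on A,
    0 on B and carries no current into the other nodes ([geff_potential]). As z is not
    constant, positivity of L on nonconstant vectors makes every geff positive. In
    particular it does so along any sequential inclusion, and one exists. Conversely, L is
    positive definite on vectors vanishing on the nodes of negative lines, because there
    only positive weights contribute and the graph is connected
    ([posdef_on_nonneg_nodes]). Releasing the nodes of the sequence one at a time, from
    the last to the second, preserves definiteness, because the quantity to be checked at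
    each step is the effective conductance of the released node against the nodes still
    held at 0 ([posdef_on_extend]). When a single node is held, this is positivity on
    nonconstant vectors ([pos_nonconst_of_sequence]). Without negative lines, any single
    bus can be held from the start. *)

(** * Quadratic forms *)

Lemma cV_neq0 (V : nmodType) (n : nat) (x : 'cV[V]_n) :
  x != 0 -> exists i, x i ord0 != 0.
Proof.
move=> x0; apply/existsP; apply: contraNT x0 => /existsPn x0.
by apply/eqP/colP => i; rewrite mxE; apply/eqP; have := x0 i; rewrite negbK.
Qed.

Lemma singular_kernelP (F : fieldType) (n : nat) (A : 'M[F]_n) :
  reflect (exists2 x : 'cV[F]_n, x != 0 & A *m x = 0) (A \notin unitmx).
Proof.
rewrite -unitmx_tr unitmxE unitfE negbK.
apply: (iffP det0P) => -[v v0 vA]; exists v^T; rewrite ?trmx_eq0 //.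
  by rewrite -[A]trmxK -trmx_mul vA trmx0.
by rewrite -trmx_mul vA trmx0.
Qed.

Section BilinearForms.
Variable R : realFieldType.

Definition bform (n : nat) (A : 'M[R]_n) (x y : 'cV[R]_n) : R :=
  (x^T *m A *m y) ord0 ord0.

Definition qform (n : nat) (A : 'M[R]_n) (x : 'cV[R]_n) : R := bform A x x.

Definition posdef (n : nat) (A : 'M[R]_n) : Prop :=
  forall x : 'cV[R]_n, x != 0 -> 0 < qform A x.

Definition possemidef (n : nat) (A : 'M[R]_n) : Prop :=
  forall x : 'cV[R]_n, 0 <= qform A x.

Section Fixed.
Variables (n : nat) (A : 'M[R]_n).
Implicit Types x y z : 'cV[R]_n.

Lemma bformDl x y z : bform A (x + y) z = bform A x z + bform A y z.
Proof. by rewrite /bform linearD /= !mulmxDl mxE. Qed.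

Lemma bformDr x y z : bform A x (y + z) = bform A x y + bform A x z.
Proof. by rewrite /bform mulmxDr mxE. Qed.

Lemma bformZl a x y : bform A (a *: x) y = a * bform A x y.
Proof. by rewrite /bform linearZ /= -!scalemxAl mxE. Qed.

Lemma bformZr a x y : bform A x (a *: y) = a * bform A x y.
Proof. by rewrite /bform -scalemxAr mxE. Qed.

Lemma bformC x y : A^T = A -> bform A x y = bform A y x.
Proof.
move=> As; rewrite /bform -[LHS](mxE trmx_key (fun i j => _ j i)) -/(trmx _).
by rewrite !trmx_mul trmxK As mulmxA.
Qed.

Lemma qformZ a x : qform A (a *: x) = a ^+ 2 * qform A x.
Proof. by rewrite /qform bformZl bformZr mulrA expr2. Qed.

Lemma qformD x y : A^T = A ->
  qform A (x + y) = qform A x + 2 * bform A x y + qform A y.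
Proof.
by move=> As; rewrite /qform bformDl !bformDr (bformC y x As); ring.
Qed.

Lemma qform0 : qform A 0 = 0.
Proof. by rewrite /qform /bform mulmx0 mxE. Qed.

Lemma bformE x y : bform A x y = \sum_j \sum_i x i ord0 * A i j * y j ord0.
Proof.
rewrite /bform mxE; apply: eq_bigr => j _; rewrite mxE mulr_suml.
by apply: eq_bigr => i _; rewrite !mxE.
Qed.

End Fixed.

Lemma bformDm (n : nat) (A B : 'M[R]_n) x y :
  bform (A + B) x y = bform A x y + bform B x y.
Proof. by rewrite /bform mulmxDr mulmxDl mxE. Qed.

Lemma bformZm (n : nat) a (A : 'M[R]_n) x y : bform (a *: A) x y = a * bform A x y.
Proof. by rewrite /bform -scalemxAr -scalemxAl mxE. Qed.

Lemma qform_congr (m n : nat) (A : 'M[R]_n) (P : 'M[R]_(n, m)) x :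
  qform (P^T *m A *m P) x = qform A (P *m x).
Proof. by rewrite /qform /bform trmx_mul !mulmxA. Qed.

Lemma qform_diag (n : nat) (v : 'rV[R]_n) x :
  qform (diag_mx v) x = \sum_i v ord0 i * x i ord0 ^+ 2.
Proof.
rewrite /qform bformE; apply: eq_bigr => j _.
rewrite (bigD1 j) //= big1 ?addr0 => [|i /negPf ij].
  by rewrite mxE eqxx mulr1n; ring.
by rewrite mxE ij mulr0n mulr0 mul0r.
Qed.

Lemma posdef_diag (n : nat) (v : 'rV[R]_n) :
  (forall i, 0 < v ord0 i) -> posdef (diag_mx v).
Proof.
move=> v0 x x0; rewrite qform_diag.
have [i xi] := cV_neq0 x0.
rewrite (bigD1 i) //=; apply: ltr_pwDl; first by rewrite mulr_gt0 ?exprn_even_gt0.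
by apply: sumr_ge0 => j _; rewrite mulr_ge0 ?sqr_ge0 // ltW.
Qed.

Lemma posdef_semi (n : nat) (A : 'M[R]_n) : posdef A -> possemidef A.
Proof.
move=> pA x; have [->|/pA/ltW //] := eqVneq x 0; by rewrite qform0.
Qed.

Lemma posdef_unit (n : nat) (A : 'M[R]_n) : posdef A -> A \in unitmx.
Proof.
move=> pA; apply/negPn/singular_kernelP => -[x /pA].
by rewrite /qform /bform -mulmxA => + Ax; rewrite Ax mulmx0 mxE ltxx.
Qed.

Lemma qform_invmx (n : nat) (A : 'M[R]_n) x :
  A^T = A -> A \in unitmx -> qform (invmx A) x = qform A (invmx A *m x).
Proof. by move=> As Au; rewrite -qform_congr trmx_inv As mulVmx // mul1mx. Qed.

Lemma posdef_invmx (n : nat) (A : 'M[R]_n) :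
  A^T = A -> posdef A -> posdef (invmx A).
Proof.
move=> As pA x x0; have Au := posdef_unit pA; rewrite qform_invmx //; apply: pA.
by apply: contra_neq x0 => y0; rewrite -[x](mulKVmx Au) y0 mulmx0.
Qed.

End BilinearForms.

Notation sqnorm x := (qform 1%:M x).

Section Coercivity.
Variable R : realFieldType.

Lemma cauchy_schwarz (n : nat) (A : 'M[R]_n) x y : A^T = A -> possemidef A ->
  bform A x y ^+ 2 <= qform A x * qform A y.
Proof.
move=> As pA.
have pos t u : 0 <= t ^+ 2 * qform A x + 2 * (t * (u * bform A x y))
                    + u ^+ 2 * qform A y.
  by have := pA (t *: x + u *: y); rewrite qformD // !qformZ bformZl bformZr.
have y0 := pA y; move: (bform A x y) (qform A x) (qform A y) pos y0 => b a c pos.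
rewrite le_eqVlt => /predU1P[c0|c0].
  (* A null y: the choice of t and u leaves only - b ^+ 2, which is then >= 0. *)
  have := pos b (- (a + 1) / 2); rewrite -c0 mulr0 addr0.
  have -> : b ^+ 2 * a + 2 * (b * (- (a + 1) / 2 * b)) = - b ^+ 2 by field.
  by rewrite oppr_ge0 mulr0.
have := pos c (- b).
have -> : c ^+ 2 * a + 2 * (c * (- b * b)) + (- b) ^+ 2 * c = c * (a * c - b ^+ 2).
  by ring.
by rewrite pmulr_rge0 // subr_ge0.
Qed.

Lemma sqnormE (n : nat) (x : 'cV[R]_n) : sqnorm x = \sum_i x i ord0 ^+ 2.
Proof.
rewrite -diag_const_mx qform_diag.
by apply: eq_bigr => i _; rewrite mxE mul1r.
Qed.

Lemma sqnorm_posdef (n : nat) : posdef (1%:M : 'M[R]_n).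
Proof. by rewrite -diag_const_mx; apply: posdef_diag => i; rewrite mxE. Qed.

Lemma qform_bounded (n : nat) (A : 'M[R]_n) :
  exists2 C, 0 < C & forall x, `|qform A x| <= C * sqnorm x.
Proof.
exists (1 + \sum_j \sum_i `|A i j|) => [|x].
  by rewrite ltr_pwDl // sumr_ge0 // => j _; rewrite sumr_ge0.
have x0 : 0 <= sqnorm x by apply: posdef_semi; apply: sqnorm_posdef.
rewrite mulrDl mul1r -[X in X <= _]add0r lerD // /qform bformE mulr_suml.
apply: le_trans (ler_norm_sum _ _ _) _; apply: ler_sum => j _.
rewrite mulr_suml; apply: le_trans (ler_norm_sum _ _ _) _; apply: ler_sum => i _.
rewrite mulrAC mulrC normrM ler_wpM2l //.
have coord k : x k ord0 ^+ 2 <= sqnorm x.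
  rewrite sqnormE (bigD1 k) //= lerDl; apply: sumr_ge0 => l _; exact: sqr_ge0.
have := coord i; have := coord j; rewrite ler_norml -/(qform _ _).
move: (x i ord0) (x j ord0) (sqnorm x) => u v s us vs.
by apply/andP; split; nra.
Qed.

(** Cauchy-Schwarz for the form of A, applied to A x and x, gives
    |A x|^4 <= C |A x|^2 (x^T A x), so x^T A x dominates |A x|^2, which dominates
    |x|^2 as A is invertible. A uniform c is what makes definiteness survive a small
    perturbation of A. *)
Lemma coercive (n : nat) (A : 'M[R]_n) : A^T = A -> possemidef A -> A \in unitmx ->
  exists2 c, 0 < c & forall x, c * sqnorm x <= qform A x.
Proof.
move=> As pA Au.
have [C C0 bA] := qform_bounded A.
have [C' C'0 bI] := qform_bounded ((invmx A)^T *m invmx A).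
have image_le x : sqnorm (A *m x) <= C * qform A x.
  have eqb : bform A (A *m x) x = sqnorm (A *m x).
    by rewrite /qform /bform !trmx_mul As mulmx1 !mulmxA.
  have := cauchy_schwarz (A *m x) x As pA; rewrite eqb.
  have := le_trans (ler_norm _) (bA (A *m x)); have := pA x; have := pA (A *m x).
  have := posdef_semi (@sqnorm_posdef n) (A *m x).
  move: (sqnorm _) (qform A (A *m x)) (qform A x) => s p q s0 p0 q0 pC spq.
  have [s1|s1] := ltP 0 s; last by rewrite (le_trans s1) // mulr_ge0 // ltW.
  have : s * s <= s * (C * q) by nra.
  by rewrite ler_pM2l.
exists (C' * C)^-1 => [|x]; first by rewrite invr_gt0 mulr_gt0.
rewrite mulrC ler_pdivrMr ?mulr_gt0 // mulrC -mulrA.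
rewrite -[x in X in X <= _](mulKmx Au) -qform_congr mulmx1.
apply: le_trans (ler_norm _) _; apply: le_trans (bI _) _.
by rewrite ler_pM2l.
Qed.

End Coercivity.

(** * Singular members of a quadratic pencil *)

Section Pencil.
Variable R : realType.

(** At a fixed vector, the form of a pencil at s + h, expanded around s, has this shape,
    with a its value at s: negativity at s extends beyond s. *)
Lemma small_step (a d m : R) : a < 0 -> 0 <= d -> 0 <= m ->
  exists2 h, 0 < h & h ^+ 2 * m + h * d + a < 0.
Proof.
move=> a0 d0 m0; have p0 : 0 < m + d - a by lra.
exists (- a / (m + d - a)); first by rewrite divr_gt0 ?oppr_gt0.
set h := _ / _; have hE : h * (m + d - a) = - a by rewrite divfK // gt_eqF.
have h0 : 0 < h by rewrite divr_gt0 ?oppr_gt0.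
have h1 : h <= 1 by rewrite ler_pdivrMr // mul1r; lra.
have : 0 <= h * m * (1 - h).
  by rewrite mulr_ge0 ?subr_ge0 // mulr_ge0 // ltW.
have : h * a < 0 by rewrite pmulr_rlt0.
nra.
Qed.

(** Write K t for the matrix of the pencil. Its form takes a negative value at t = 0
    and none for large t, since t D outweighs A. At the supremum s of the t with a
    negative value, K s is semidefinite, because a negative value at s would persist a
    little beyond s; were K s invertible it would be coercive, hence so would K t for t
    slightly below s, against the choice of s. *)
Lemma singular_pencil (n : nat) (A D M : 'M[R]_n) :
  A^T = A -> D^T = D -> M^T = M -> posdef D -> possemidef M ->
  forall v, qform A v < 0 ->
  exists t, 0 < t /\ exists2 x : 'cV[R]_n, x != 0 & (t ^+ 2 *: M + t *: D + A) *m x = 0.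
Proof.
move=> As Ds Ms pD pM v Av.
pose K t := t ^+ 2 *: M + t *: D + A.
have KE t x : qform (K t) x = t ^+ 2 * qform M x + t * qform D x + qform A x.
  by rewrite /qform !bformDm !bformZm.
have Ks t : (K t)^T = K t by rewrite /K !linearD /= !linearZ /= As Ds Ms.
have D0 := posdef_semi pD.
pose S : set R := fun t => 0 <= t /\ exists x, qform (K t) x < 0.
have step s : S s -> exists2 t, s < t & S t.
  move=> [s0 [x]]; rewrite KE => neg.
  have [||h h0 hneg] := small_step (d := 2 * s * qform M x + qform D x)
                          (m := qform M x) neg.
  - by rewrite addr_ge0 // mulr_ge0 // mulr_ge0.
  - exact: pM.
  exists (s + h); first by rewrite ltrDl.
  split; first by rewrite addr_ge0 // ltW.
  exists x; rewrite KE; move: hneg; congr (_ < 0); ring.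
have S0 : S 0.
  by split=> //; exists v; rewrite KE expr0n /= !mul0r !add0r.
have supS : has_sup S.
  split; first by exists 0.
  have [C C0 bA] := qform_bounded A.
  have [c c0 bD] := coercive Ds D0 (posdef_unit pD).
  exists (C / c) => t [t0 [x]]; rewrite KE => neg.
  rewrite ler_pdivlMr // leNgt; apply/negP => tC.
  have := bD x; have := pM x; have := bA x.
  have := posdef_semi (@sqnorm_posdef R n) x.
  rewrite ler_norml => N0 /andP[Al _] M0 Dl.
  have : 0 <= t ^+ 2 * qform M x by rewrite mulr_ge0 // sqr_ge0.
  move: (t ^+ 2 * _) neg => m neg m0.
  have : t * (c * sqnorm x) <= t * qform D x by rewrite ler_wpM2l.
  nra.
pose s := sup S.
have le_s t : S t -> t <= s by exact: sup_upper_bound.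
have sS : ~ S s by move=> /step[t st /le_s]; rewrite leNgt st.
have s0 : 0 < s.
  by have [t t0 /le_s] := step _ S0; apply: lt_le_trans.
have psd : possemidef (K s).
  move=> x; rewrite leNgt; apply/negP => neg.
  by apply: sS; split; [exact: ltW|exists x].
exists s; split=> //; apply/singular_kernelP/negP => Ku.
have [c c0 bK] := coercive (Ks s) psd Ku.
(* For 0 <= t <= s, K s - K t is at most (s - t) (2 s M + D). *)
have [C C0 bB] := qform_bounded (2 * s *: M + D).
have [t St] : exists2 t, S t & s - c / C < t.
  by apply: sup_adherent => //; rewrite divr_gt0.
rewrite ltrBlDl -ltrBlDr ltr_pdivlMr // => stC.
case: (St) => t0 [x neg]; have ts := le_s _ St.
have := le_trans (ler_norm _) (bB x); rewrite /qform bformDm bformZm -!/(qform _ _).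
have := bK x; move: (neg); rewrite !KE.
have x0 : 0 < sqnorm x.
  apply: sqnorm_posdef; apply/eqP => x0.
  by move: neg; rewrite x0 qform0 ltxx.
have := pM x; have := D0 x.
move: (qform M x) (qform D x) (qform A x) (sqnorm x) x0 {neg}.
move=> m d a N N0 d0 m0 neg cN bN.
have : (s - t) * (2 * s * m + d) <= (s - t) * (C * N) by rewrite ler_wpM2l ?subr_ge0.
have : (s - t) * C * N < c * N by rewrite ltr_pM2r.
have : 0 <= (s - t) * (s - t) * m by rewrite mulr_ge0 // -expr2 sqr_ge0.
nra.
Qed.

End Pencil.

(** * Definiteness on a set of nodes and effective conductance *)

Section Restriction.
Variables (R : realType) (n : nat).
Implicit Types (A B C S : {set 'I_n}) (L : 'M[R]_n).

Definition supported S (x : 'cV[R]_n) := forall i, i \notin S -> x i ord0 = 0.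

Definition posdef_on L S :=
  forall x, supported S x -> x != 0 -> 0 < qform L x.

Definition inclusion_mx S : 'M[R]_(n, #|S|) :=
  \matrix_(i, k) (i == enum_val k)%:R.

Lemma inclusion_mxE S (y : 'cV[R]_#|S|) k :
  (inclusion_mx S *m y) (enum_val k) ord0 = y k ord0.
Proof.
rewrite mxE (bigD1 k) //= mxE eqxx mul1r big1 ?addr0 // => l lk.
by rewrite mxE (inj_eq enum_val_inj) eq_sym (negPf lk) mul0r.
Qed.

Lemma inclusion_mx_out S (y : 'cV[R]_#|S|) : supported S (inclusion_mx S *m y).
Proof.
move=> i iS; rewrite mxE big1 // => k _; rewrite mxE.
by case: eqP iS => [->|]; rewrite ?enum_valP // mul0r.
Qed.

Lemma submx_setE L A B :
  submx_set L A B = (inclusion_mx A)^T *m L *m inclusion_mx B.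
Proof.
apply/matrixP => a b; rewrite !mxE (bigD1 (enum_val b)) //= !mxE eqxx mulr1.
rewrite (bigD1 (enum_val a)) //= !mxE eqxx mul1r.
rewrite !big1 ?addr0 // => i ia; rewrite !mxE (negPf ia) ?mul0r ?mulr0 //.
Qed.

Lemma submx_set_mul L S (x : 'cV[R]_n) k :
  ((inclusion_mx S)^T *m L *m x) k ord0 = (L *m x) (enum_val k) ord0.
Proof.
have trE i : (inclusion_mx S)^T k i = (i == enum_val k)%:R by rewrite !mxE.
rewrite -mulmxA [LHS]mxE (bigD1 (enum_val k)) //= trE eqxx mul1r.
by rewrite big1 ?addr0 // => i /negPf ik; rewrite trE ik mul0r.
Qed.

Lemma posdef_on_sub L S S' : S \subset S' -> posdef_on L S' -> posdef_on L S.
Proof.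
move=> SS' pL x xS; apply: pL => i iS'; apply: xS.
by apply: contra iS'; apply: (fintype.subsetP SS').
Qed.

Lemma posdef_on_submx_unit L S : posdef_on L S -> submx_set L S S \in unitmx.
Proof.
move=> pL; apply: posdef_unit => y y0.
rewrite submx_setE qform_congr; apply: pL; first exact: inclusion_mx_out.
apply: contra_neq y0 => Ey0; apply/colP => k.
by rewrite -inclusion_mxE Ey0 !mxE.
Qed.

(** Hold the nodes of A at voltage 1, those of B at voltage 0, and let the others
    float, so that no current enters at C: the potential z solves a linear system
    with matrix L_cc, and the effective conductance is the power z^T L z. In this
    form it can be compared with the quadratic form of L. *)
Lemma geff_potential L A B :
  let C := (~: (A :|: B))%SET in
  L^T = L -> [disjoint A & B] -> submx_set L C C \in unitmx ->
  exists z : 'cV[R]_n, [/\ forall i, i \in A -> z i ord0 = 1,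
    forall i, i \in B -> z i ord0 = 0,
    forall i, i \in C -> (L *m z) i ord0 = 0 &
    geff L A B = qform L z].
Proof.
move=> C Ls dAB Cu.
pose one : 'cV[R]_#|A| := const_mx 1.
pose y := - (invmx (submx_set L C C) *m submx_set L C A *m one).
pose EA := inclusion_mx A; pose EC := inclusion_mx C.
have AC i : i \in A -> i \notin C by rewrite !inE => ->.
have BC i : i \in B -> i \notin C by rewrite !inE => ->; rewrite orbT.
have BA i : i \in B -> i \notin A by move=> iB; rewrite (disjointFl dAB).
have zC : EC^T *m L *m (EA *m one + EC *m y) = 0.
  rewrite mulmxDr !mulmxA -!submx_setE /y mulmxN !mulmxA mulmxV // mul1mx.
  by rewrite subrr.
exists (EA *m one + EC *m y); split=> [i iA|i iB|i iC|].
- rewrite mxE (inclusion_mx_out _ (AC _ iA)) addr0.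
  by rewrite -(enum_rankK_in iA iA) inclusion_mxE mxE.
- by rewrite mxE (inclusion_mx_out _ (BC _ iB)) (inclusion_mx_out _ (BA _ iB)) addr0.
- by rewrite -(enum_rankK_in iC iC) -submx_set_mul zC mxE.
have symAC : (submx_set L A C)^T = submx_set L C A.
  by rewrite !submx_setE !trmx_mul Ls trmxK mulmxA.
have zLz : (EA *m one + EC *m y)^T *m L *m (EA *m one + EC *m y) =
           one^T *m submx_set L A A *m one + one^T *m submx_set L A C *m y.
  have -> : (EA *m one + EC *m y)^T = one^T *m EA^T + y^T *m EC^T.
    by rewrite linearD /= !trmx_mul.
  rewrite 2!mulmxDl -(mulmxA y^T) -(mulmxA y^T) zC mulmx0 addr0.
  by rewrite mulmxDr !submx_setE !mulmxA.
rewrite /qform /bform zLz.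
have -> : geff L A B =
    ((col_mx one 0)^T *m schur_compl L A B *m col_mx one 0) ord0 ord0 by [].
rewrite /schur_compl -/C.
rewrite mulmxBr mulmxBl tr_col_mx mul_row_block mul_row_col !mulmxA mul_row_col.
rewrite -!(mulmxA _ (row_mx _ _)) mul_row_col.
rewrite !(mulmx0, addr0, mul0mx, trmx0).
by rewrite symAC /y mulmxN !mulmxA.
Qed.

Lemma geff_gt0_of_posdef L A B : L^T = L -> [disjoint A & B] ->
  A != finset.set0 -> posdef_on L (~: B)%SET -> geff_gt0 L A B.
Proof.
move=> Ls dAB /set0Pn[i iA] pL.
have Cu : submx_set L (~: (A :|: B))%SET (~: (A :|: B))%SET \in unitmx.
  apply: posdef_on_submx_unit; apply: posdef_on_sub pL.
  by rewrite finset.setCS finset.subsetUr.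
split=> //; have [z [zA zB _ ->]] := geff_potential Ls dAB Cu.
apply: pL => [j|]; first by rewrite inE negbK; exact: zB.
apply/eqP => z0; have := zA i iA; rewrite z0 mxE => /esym/eqP.
by rewrite oner_eq0.
Qed.

(** With z the potential of geff, every x vanishing on B is t z + y with t = x_v and y
    vanishing on v |: B; as L z vanishes off v |: B, the two parts are L-orthogonal,
    so the form at x is t^2 geff plus the form at y. *)
Lemma posdef_on_extend L v B : L^T = L -> v \notin B ->
  posdef_on L (~: (v |: B))%SET -> geff_gt0 L [set v]%SET B ->
  posdef_on L (~: B)%SET.
Proof.
move=> Ls vB pL [Cu]; have dvB : [disjoint [set v] & B] by rewrite disjoints1.
have [z [zv zB zC ->]] := geff_potential Ls dvB Cu => zpos x xB x0.
pose t := x v ord0; pose y := x - t *: z.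
have zv1 : z v ord0 = 1 by apply: zv; rewrite inE.
have yS : supported (~: (v |: B))%SET y.
  move=> i; rewrite !inE negbK !mxE => /orP[/eqP ->|iB].
    by rewrite zv1 mulr1 subrr.
  by rewrite zB // xB ?inE ?negbK // mulr0 subrr.
have yz : bform L y z = 0.
  rewrite /bform -mulmxA mxE big1 // => i _; rewrite mxE.
  have [iC|iC] := boolP (i \in (~: (v |: B))%SET); last by rewrite yS ?mul0r.
  by rewrite zC ?mulr0.
have -> : x = y + t *: z by rewrite subrK.
rewrite qformD // bformZr yz !mulr0 addr0 qformZ.
have [t0|t0] := eqVneq t 0.
  rewrite t0 expr0n mul0r addr0; apply: pL => //.
  by rewrite /y t0 scale0r subr0.
have [->|y0] := eqVneq y 0.
  by rewrite qform0 add0r mulr_gt0 // exprn_even_gt0.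
by rewrite addr_gt0 ?pL // mulr_gt0 // exprn_even_gt0.
Qed.

Lemma posdef_on_sequence L S (U : nat -> {set 'I_n}) : L^T = L ->
  sequential_inclusion S U -> posdef_on L (~: S)%SET ->
  (forall k, (1 <= k <= #|S|.-1)%N -> geff_gt0 L (U k.+1 :\: U k)%SET (U k)) ->
  forall k, (1 <= k <= #|S|)%N -> posdef_on L (~: U k)%SET.
Proof.
move=> Ls [Ustep US] pS Ug k.
have [m] := ubnP (#|S| - k); elim: m k => // m IH k km /andP[k1 kS].
have [->|kneq] := eqVneq k #|S|; first by rewrite US.
have kS' : (k < #|S|)%N by rewrite ltn_neqAle kneq.
have [Uk cUk] := Ustep k (introT andP (conj k1 kS')).
have /cards1P[v vE] : #|U k.+1 :\: U k| == 1%N.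
  by rewrite cardsD (finset.setIidPr Uk) cUk subSnn.
have vD : v \in (U k.+1 :\: U k)%SET by rewrite vE inE.
have Ueq : U k.+1 = (v |: U k)%SET.
  by rewrite -vE -{1}(finset.setID (U k.+1) (U k)) (finset.setIidPr Uk) finset.setUC.
apply: (posdef_on_extend (v := v)) => //.
- by move: vD; rewrite inE => /andP[].
- rewrite -Ueq; apply: IH; last by rewrite kS'.
  by rewrite -ltnS (leq_trans _ km) // ltnS subnSK // leqnn.
- rewrite -vE; apply: Ug; rewrite k1 /=.
  by rewrite -ltnS prednK // (leq_ltn_trans _ kS').
Qed.

(** For a symmetric L that annihilates constants this is L >= 0 with kernel spanned
    by the constant vector. *)
Definition pos_nonconst L :=
  forall x : 'cV[R]_n, (exists i j, x i ord0 != x j ord0) -> 0 < qform L x.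

Lemma qform_shift L t (x : 'cV[R]_n) : L^T = L -> L *m const_mx 1 = 0 :> 'cV[R]_n ->
  qform L (x + const_mx t) = qform L x.
Proof.
move=> Ls L1; have Lt : L *m const_mx t = 0 :> 'cV[R]_n.
  have -> : const_mx t = t *: const_mx 1 :> 'cV[R]_n.
    by apply/colP => i; rewrite !mxE mulr1.
  by rewrite -scalemxAr L1 scaler0.
by rewrite qformD // /qform /bform -!mulmxA Lt !mulmx0 !mxE mulr0 !addr0.
Qed.

(** Subtracting the constant x_i grounds node i and does not change the form. *)
Lemma pos_nonconstP L i : L^T = L -> L *m const_mx 1 = 0 :> 'cV[R]_n ->
  posdef_on L [set~ i]%SET <-> pos_nonconst L.
Proof.
move=> Ls L1; split=> pL x.
  move=> [j [k jk]]; rewrite -(qform_shift (- x i ord0) x Ls L1).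
  apply: pL => [l|].
    by rewrite !inE negbK => /eqP ->; rewrite !mxE subrr.
  apply: contra_neq jk => y0.
  have E l : x l ord0 = x i ord0.
    by apply/eqP; rewrite -subr_eq0; have /colP/(_ l) := y0; rewrite !mxE => ->.
  by rewrite !E.
move=> xi x0; apply: pL.
have [j xj] := cV_neq0 x0.
by exists j, i; rewrite [x i _]xi // !inE negbK.
Qed.

(** The last set U 1 of the descent is a single node, and grounding one node is enough. *)
Lemma pos_nonconst_of_sequence L S U :
  L^T = L -> L *m const_mx 1 = 0 :> 'cV[R]_n -> S != finset.set0 ->
  sequential_inclusion S U -> posdef_on L (~: S)%SET ->
  (forall k, (1 <= k <= #|S|.-1)%N -> geff_gt0 L (U k.+1 :\: U k)%SET (U k)) ->
  pos_nonconst L.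
Proof.
move=> Ls L1 S0 sU pS gU; have S1 : (0 < #|S|)%N by rewrite card_gt0.
have cU k : (k < #|S|)%N -> #|U k.+1| = k.+1.
  have [Ustep US] := sU.
  have : (forall m, m < #|S| -> #|U (#|S| - m)%N| = (#|S| - m)%N)%N.
    elim=> [|m IH] mS; first by rewrite subn0 US.
    have := IH (ltnW mS); rewrite -(subnSK (ltnW mS)) => E.
    have [|_] := Ustep (#|S| - m.+1)%N.
      by rewrite subn_gt0 mS ltn_subrL.
    by rewrite E => -[].
  move=> H kS; have := H (#|S| - k.+1)%N; rewrite subKn //; apply.
  by rewrite -subn_gt0 subKn.
have /cards1P[v vE] : #|U 1%N| == 1%N by rewrite cU.
apply/(pos_nonconstP v Ls L1); rewrite -vE.
by apply: (posdef_on_sequence Ls sU pS gU); rewrite S1.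
Qed.

End Restriction.

Definition prefix_set (T : finType) (S : {set T}) k : {set T} :=
  [set x in take k (enum S)]%SET.

Lemma card_prefix_set (T : finType) (S : {set T}) k :
  (k <= #|S|)%N -> #|prefix_set S k| = k.
Proof.
move=> kS; rewrite cardsE (card_uniqP _) ?take_uniq ?enum_uniq //.
by rewrite size_takel // -cardE.
Qed.

Lemma prefix_sequential_inclusion (T : finType) (S : {set T}) :
  sequential_inclusion S (prefix_set S).
Proof.
split=> [k /andP[_ kS]|]; last first.
  by apply/finset.setP => x; rewrite inE cardE take_size mem_enum.
split; last by rewrite !card_prefix_set // ltnW.
apply/fintype.subsetP => x; rewrite !inE (take_nth x) ?mem_rcons ?inE -?cardE //.
by move=> ->; rewrite orbT.
Qed.

(** * Eigenvalues of a real matrix *)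

Section Spectrum.
Variables (R : realType) (m : nat).
Implicit Types (A : 'M[R]_m).

(** [eigenvalue] is about row vectors; the linearization acts on columns. *)
Lemma eigenvalue_colP (F : fieldType) (A : 'M[F]_m) (a : F) :
  reflect (exists2 x : 'cV[F]_m, A *m x = a *: x & x != 0) (eigenvalue A a).
Proof.
rewrite /eigenvalue /eigenspace kermx_eq0 row_free_unit.
by apply: (iffP (singular_kernelP _)) => [[x x0 Ax]|[x Ax x0]]; exists x => //;
  apply/eqP; move/eqP: Ax; rewrite mulmxBl mul_scalar_mx subr_eq0.
Qed.

Lemma mem_eigenvalues A z :
  (z \in eigenvalues A) = eigenvalue (map_mx (real_complex R) A) z.
Proof.
rewrite eigenvalue_root_char /eigenvalues.
case: closed_field_poly_normal => r /= ->.
by rewrite (monicP (char_poly_monic _)) scale1r root_prod_XsubC.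
Qed.

Lemma hyperbolic_stableP A :
  i_zero A = 0%N /\ i_plus A = 0%N <->
  forall z, z \in eigenvalues A -> complex.Re z < 0.
Proof.
rewrite /i_zero /i_plus; split=> [[z0 zp] z zA|H].
  have := @has_count _ (fun z : R[i] => complex.Re z == 0) (eigenvalues A).
  rewrite z0 => /negbT/hasPn/(_ z zA) /= n0.
  have := @has_count _ (fun z : R[i] => 0 < complex.Re z) (eigenvalues A).
  rewrite zp => /negbT/hasPn/(_ z zA) /=.
  by rewrite -leNgt le_eqVlt (negPf n0).
by split; apply/eqP; rewrite eqn0Ngt -has_count; apply/hasPn => z /H /=;
  [move=> /lt_eqF ->|rewrite -leNgt; exact: ltW].
Qed.

Lemma eigenvalues_real A a (x : 'cV[R]_m) :
  A *m x = a *: x -> x != 0 -> a%:C%C \in eigenvalues A.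
Proof.
move=> Ax x0; rewrite mem_eigenvalues; apply/eigenvalue_colP.
exists (map_mx (real_complex R) x); last by rewrite map_mx_eq0.
by rewrite -map_mxM Ax map_mxZ.
Qed.

(** u and w are the real and imaginary parts of an eigenvector, so that energy
    arguments on complex eigenvectors can be run over the reals. *)
Lemma eigenvalues_split A z : z \in eigenvalues A ->
  exists u w : 'cV[R]_m, [/\ (u != 0) || (w != 0),
    A *m u = complex.Re z *: u - complex.Im z *: w &
    A *m w = complex.Im z *: u + complex.Re z *: w].
Proof.
rewrite mem_eigenvalues => /eigenvalue_colP[x Ax x0].
exists (map_mx (@complex.Re R) x), (map_mx (@complex.Im R) x).
have xi i : (map_mx (real_complex R) A *m x) i ord0 = z * x i ord0.
  by rewrite Ax mxE.
split.
- apply: contraNT x0; rewrite negb_or !negbK => /andP[/eqP/colP u0 /eqP/colP w0].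
  apply/eqP/colP => i; have := u0 i; have := w0 i; rewrite !mxE.
  by case: (x i ord0) => a b /= -> ->.
- apply/colP => i; have /(congr1 (@complex.Re R)) := xi i; rewrite !mxE raddf_sum /=.
  have -> : complex.Re (z * x i ord0) = complex.Re z * complex.Re (x i ord0)
              - complex.Im z * complex.Im (x i ord0).
    by case: z {Ax xi} => a b; case: (x i ord0).
  move=> <-; apply: eq_bigr => j _; rewrite !mxE.
  by case: (x j ord0) => a b /=; rewrite mul0r subr0.
- apply/colP => i; have /(congr1 (@complex.Im R)) := xi i; rewrite !mxE raddf_sum /=.
  have -> : complex.Im (z * x i ord0) = complex.Im z * complex.Re (x i ord0)
              + complex.Re z * complex.Im (x i ord0).
    by case: z {Ax xi} => a b; case: (x i ord0) => c e /=; rewrite addrC.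
  move=> <-; apply: eq_bigr => j _; rewrite !mxE.
  by case: (x j ord0) => a b /=; rewrite mul0r addr0.
Qed.

End Spectrum.

(** * The Laplacian of the flow graph *)

Section Laplacian.
Variables (R : realType) (g d : nat) (N : power_network R g d).
Local Notation n := (g + d)%N.
Variables (O : {set 'I_n * 'I_n}) (theta : 'cV[R]_n).
Local Notation L := (laplacian N O theta).

Lemma laplacian_sym : L^T = L.
Proof. by rewrite /laplacian !trmx_mul trmxK tr_diag_mx mulmxA. Qed.

Lemma incidence_tr_mul (x : 'cV[R]_n) k :
  ((incidence R O)^T *m x) k ord0 =
  x (enum_val k).1 ord0 - x (enum_val k).2 ord0.
Proof.
have sum_delta i0 : \sum_i (i == i0)%:R * x i ord0 = x i0 ord0.
  rewrite (bigD1 i0) //= eqxx mul1r big1 ?addr0 // => i /negPf ->.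
  by rewrite mul0r.
rewrite mxE -[in RHS]sum_delta -[X in _ - X]sum_delta -sumrB.
by apply: eq_bigr => i _; rewrite !mxE mulrBl.
Qed.

Lemma laplacian_const : L *m const_mx 1 = 0 :> 'cV[R]_n.
Proof.
rewrite /laplacian -mulmxA.
have -> : (incidence R O)^T *m const_mx 1 = 0 :> 'cV[R]_#|O|.
  by apply/colP => k; rewrite incidence_tr_mul !mxE subrr.
by rewrite mulmx0.
Qed.

Lemma qform_laplacian x : qform L x =
  \sum_k weight N theta (enum_val k).1 (enum_val k).2 *
    (x (@enum_val _ (mem O) k).1 ord0 - x (enum_val k).2 ord0) ^+ 2.
Proof.
rewrite /laplacian -[X in X *m _ *m _]trmxK qform_congr qform_diag.
by apply: eq_bigr => k _; rewrite mxE incidence_tr_mul.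
Qed.

Lemma weight_sym i j : line N i j -> weight N theta i j = weight N theta j i.
Proof.
by move=> ij; rewrite /weight (susc_sym ij) -cosN opprB (mulrC (volt N i)).
Qed.

Lemma connect_const (T : finType) (T' : Type) (e : rel T) (f : T -> T') :
  (forall i j, e i j -> f i = f j) -> forall i j, connect e i j -> f i = f j.
Proof.
move=> ef i j /connectP[p]; elim: p i => [|k p IH] i /=; first by move=> _ ->.
by move=> /andP[/ef -> ?] ?; apply: IH.
Qed.

Hypothesis hO : is_orientation (line N) O.
Hypothesis hw : forall i j, line N i j -> weight N theta i j != 0.

(** A line of negative weight has both ends in [neg_nodes], outside S, where x
    vanishes, so only positive weights contribute to the form. If the form vanishes,
    x is constant along each line, hence everywhere, with the value 0 it has at v. *)
Lemma posdef_on_nonneg_nodes (S : {set 'I_n}) v :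
  [disjoint S & neg_nodes N theta] -> v \notin S -> posdef_on L S.
Proof.
move=> dS vS x xS x0.
have wS i j : line N i j -> i \in S -> 0 < weight N theta i j.
  move=> ij iS; rewrite lt_neqAle eq_sym hw //= leNgt.
  have := disjointFr dS iS; rewrite inE => /negbT/existsPn/(_ j).
  by rewrite ij.
have term_ge0 i j : line N i j -> 0 <= weight N theta i j * (x i ord0 - x j ord0) ^+ 2.
  move=> ij; have [iS|iS] := boolP (i \in S).
    by rewrite mulr_ge0 ?sqr_ge0 // ltW // wS.
  have [jS|jS] := boolP (j \in S).
    by rewrite mulr_ge0 ?sqr_ge0 // weight_sym // ltW // wS // line_sym.
  by rewrite !xS // subrr expr0n mulr0.
have Oline k : line N (@enum_val _ (mem O) k).1 (enum_val k).2.
  by apply: hO.1; rewrite -surjective_pairing enum_valP.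
rewrite qform_laplacian lt_neqAle sumr_ge0 ?andbT => [|k _]; last exact: term_ge0.
apply: contra_neq x0 => /esym/psumr_eq0P zero.
have Oconst i j : (i, j) \in O -> x i ord0 = x j ord0.
  move=> ijO; have ij := hO.1 _ _ ijO.
  have /= := zero (fun k _ => term_ge0 _ _ (Oline k)) (enum_rank_in ijO (i, j)) isT.
  rewrite enum_rankK_in //= => /eqP; rewrite mulf_eq0 (negPf (hw ij)) /=.
  by rewrite expf_eq0 /= subr_eq0 => /eqP.
have const : forall i j, connect (line N) i j -> x i ord0 = x j ord0.
  apply: (connect_const (f := fun i => x i ord0)) => i j ij.
  have := hO.2 _ _ ij; have [/Oconst //|_ /=] := boolP ((i, j) \in O).
  by move=> /Oconst.
by apply/colP => i; rewrite (const _ _ (line_connected N i v)) xS ?mxE.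
Qed.

End Laplacian.

(** * Spectrum of the linearization *)

Section Linearization.
Variables (R : realType) (g d : nat) (N : power_network R g d).
Local Notation n := (g + d)%N.
Variables (O : {set 'I_n * 'I_n}) (theta : 'cV[R]_n).
Local Notation L := (laplacian N O theta).
Local Notation F := (F_mx N O theta).
Local Notation T := (T_mx R g d).
Local Notation TG := (T_G R g d).
Local Notation TL := (T_L R g d).
Local Notation J := (J_dyn N O theta).
Local Notation wd := (widen_ord (leq_pred n)).

Lemma last_bus_subproof : (n.-1 < n)%N.
Proof. by rewrite prednK // (bus_nonempty N). Qed.

Definition last_bus : 'I_n := Ordinal last_bus_subproof.

Variant bus_spec : 'I_n -> Type :=
  | LastBus : bus_spec last_bus
  | OtherBus (k : 'I_n.-1) : bus_spec (wd k).

Lemma busP i : bus_spec i.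
Proof.
have [il|il] := ltnP i n.-1.
  by have -> : i = wd (Ordinal il) by [apply: val_inj]; constructor.
have -> : i = last_bus; last by constructor.
apply/val_inj/eqP; rewrite eqn_leq il andbT -ltnS /= prednK ?(bus_nonempty N) //.
Qed.

Lemma wd_eq k l : (wd k == wd l) = (k == l).
Proof. by []. Qed.

Lemma wd_last k : (wd k == last_bus) = false.
Proof. by apply/negbTE; rewrite -(inj_eq val_inj) /= ltn_eqF. Qed.

(** E inserts a zero at the last bus: the map alpha |-> (alpha^T, 0)^T. *)
Definition grounding_mx : 'M[R]_(n, n.-1) := \matrix_(i, k) (i == wd k)%:R.
Local Notation E := grounding_mx.

Lemma grounding_mul p (X : 'M[R]_(n.-1, p)) k j : (E *m X) (wd k) j = X k j.
Proof.
rewrite mxE (bigD1 k) //= mxE eqxx mul1r big1 ?addr0 // => l lk.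
by rewrite mxE wd_eq eq_sym (negPf lk) mul0r.
Qed.

Lemma grounding_mul_last p (X : 'M[R]_(n.-1, p)) j : (E *m X) last_bus j = 0.
Proof. by rewrite mxE big1 // => l _; rewrite mxE eq_sym wd_last mul0r. Qed.

Lemma mul_grounding p (X : 'M[R]_(p, n)) i k : (X *m E) i k = X i (wd k).
Proof.
rewrite mxE (bigD1 (wd k)) //= mxE eqxx mulr1 big1 ?addr0 // => j /negPf jk.
by rewrite mxE jk mulr0.
Qed.

Lemma T_mx_wd k l : T k (wd l) = (k == l)%:R.
Proof. by rewrite mxE /= ltn_eqF. Qed.

Lemma T_mx_last k : T k last_bus = -1.
Proof. by rewrite mxE eqxx. Qed.

Lemma T_grounding : T *m E = 1%:M.
Proof. by apply/matrixP => k l; rewrite mul_grounding T_mx_wd mxE. Qed.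

Lemma grounding_T :
  E *m T = 1%:M - (const_mx 1 : 'cV_n) *m delta_mx ord0 last_bus :> 'M[R]_n.
Proof.
apply/matrixP => i j; transitivity ((i == j)%:R - (j == last_bus)%:R : R); last first.
  by rewrite !mxE big_ord1 !mxE mul1r.
case: (busP i) => [|k]; first by rewrite grounding_mul_last eq_sym subrr.
rewrite grounding_mul; case: (busP j) => [|l].
  by rewrite T_mx_last wd_last eqxx sub0r.
by rewrite T_mx_wd wd_eq wd_last subr0.
Qed.

Lemma F_mxE : F = E^T *m L *m E.
Proof.
apply/matrixP => k l; rewrite [LHS]mxE mul_grounding.
rewrite -[E^T *m L]trmxK trmx_mul trmxK [RHS]mxE mul_grounding.
by rewrite laplacian_sym -[in LHS]laplacian_sym [LHS]mxE.
Qed.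

Lemma F_mx_sym : F^T = F.
Proof. by rewrite F_mxE 2!trmx_mul trmxK laplacian_sym mulmxA. Qed.

(** E T differs from the identity by a matrix with constant columns, which L
    annihilates; dually for the transpose. *)
Lemma laplacian_F_mx : L = T^T *m F *m T.
Proof.
have LET : L *m (E *m T) = L.
  by rewrite grounding_T mulmxBr mulmx1 mulmxA laplacian_const mul0mx subr0.
rewrite F_mxE -[LHS]LET -{1}[L]laplacian_sym -[in LHS]LET trmx_mul laplacian_sym.
by rewrite trmx_mul !mulmxA.
Qed.

Lemma posdef_F_mx : posdef F <-> pos_nonconst L.
Proof.
split=> pF x.
  move=> [i [j ij]]; rewrite laplacian_F_mx qform_congr; apply: pF.
  apply: contra_neq ij => Tx0.
  have xl k : x k ord0 = x last_bus ord0.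
    apply/eqP; rewrite -subr_eq0.
    have : (E *m T *m x) k ord0 = 0 by rewrite -mulmxA Tx0 mulmx0 mxE.
    rewrite grounding_T mulmxBl mul1mx -mulmxA -rowE !mxE big_ord1 !mxE mul1r.
    by move=> ->.
  by rewrite !xl.
move=> x0; rewrite F_mxE qform_congr; apply: pF.
have [k xk] := cV_neq0 x0.
by exists (wd k), last_bus; rewrite grounding_mul grounding_mul_last.
Qed.

Lemma T_mxE : T = row_mx TG TL.
Proof. by rewrite hsubmxK. Qed.

Lemma T_mx_tr_inj (x : 'cV[R]_n.-1) : TG^T *m x = 0 -> TL^T *m x = 0 -> x = 0.
Proof.
move=> Gx Lx; rewrite -[x]mul1mx -[1%:M]trmx1 -T_grounding trmx_mul -mulmxA.
by rewrite T_mxE tr_row_mx mul_col_mx Gx Lx col_mx0 mulmx0.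
Qed.

Lemma M_posdef : posdef (M_mx N).
Proof. by apply: posdef_diag => i; rewrite mxE inertia_gt0. Qed.

Lemma D_G_posdef : posdef (D_G N).
Proof. by apply: posdef_diag => i; rewrite mxE damping_gt0. Qed.

Lemma D_L_posdef : posdef (D_L N).
Proof. by apply: posdef_diag => i; rewrite mxE damping_gt0. Qed.

Lemma J_dynE (x : 'cV[R]_n.-1) (y : 'cV[R]_g) : J *m col_mx x y =
  col_mx (- (TL *m invmx (D_L N) *m (TL^T *m F *m x)) + TG *m y)
         (- (invmx (M_mx N) *m (TG^T *m F *m x)) - invmx (M_mx N) *m (D_G N *m y)).
Proof. by rewrite /J_dyn mul_block_col !mulNmx !mulmxA. Qed.

(** The energy is x^T F x + y^T M y: with (x', y') the velocity at (x, y), the left side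
    is half its rate of change, and the coupling blocks T_G and - T_G^T F cancel, leaving
    the damping of the load and generator buses. *)
Lemma energy_dissipation (x x' : 'cV[R]_n.-1) (y y' : 'cV[R]_g) :
  J *m col_mx x y = col_mx x' y' ->
  bform F x x' + bform (M_mx N) y y' =
  - (qform (invmx (D_L N)) (TL^T *m F *m x) + qform (D_G N) y).
Proof.
rewrite J_dynE => /eq_col_mx[<- <-].
have Mu := posdef_unit M_posdef.
have yx : y^T *m TG^T *m F *m x = x^T *m F *m TG *m y.
  have <- : (x^T *m F *m TG *m y)^T = y^T *m TG^T *m F *m x.
    by rewrite 3!trmx_mul trmxK F_mx_sym !mulmxA.
  by apply/matrixP => i j; rewrite !ord1 mxE.
have zT : (TL^T *m F *m x)^T = x^T *m F *m TL.
  by rewrite 2!trmx_mul trmxK F_mx_sym mulmxA.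
rewrite /qform /bform !(mulmxDr, mulmxN) zT !mulmxA.
rewrite -![y^T *m _ *m invmx _]mulmxA mulmxV // mulmx1 yx !mxE; ring.
Qed.

(** For an eigenvalue a + i b, adding the energy balances of the real and imaginary
    parts of the eigenvector gives a (energy) = - (dissipation). If a >= 0 nothing is
    dissipated, so y and T_L^T F x vanish; then the velocity of y being 0 forces
    T_G^T F x = 0, hence T^T F x = 0 and x = 0. *)
Lemma posdef_stable : posdef F -> forall z, z \in eigenvalues J -> complex.Re z < 0.
Proof.
move=> pF z /eigenvalues_split[u [w []]].
set a := complex.Re z; set b := complex.Im z; rewrite ltNge => nz Ju Jw.
apply/negP => a0; move: nz Ju Jw.
rewrite -[u]vsubmxK -[w]vsubmxK.
move: (usubmx u) (dsubmx u) (usubmx w) (dsubmx w) => x1 y1 x2 y2.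
rewrite !scale_col_mx opp_col_mx !add_col_mx => nz J1 J2.
have Ms : (M_mx N)^T = M_mx N by rewrite tr_diag_mx.
have := congr2 +%R (energy_dissipation J1) (energy_dissipation J2).
rewrite !bformDr -!scaleNr !bformZr (bformC x2 x1 F_mx_sym) (bformC y2 y1 Ms).
rewrite -!/(qform _ _).
have pDi : posdef (invmx (D_L N)).
  by apply: posdef_invmx D_L_posdef; rewrite tr_diag_mx.
have := posdef_semi pF x1; have := posdef_semi pF x2.
have := posdef_semi M_posdef y1; have := posdef_semi M_posdef y2.
have y0 y : qform (D_G N) y <= 0 -> y = 0.
  by rewrite leNgt => yD; apply/eqP; apply: contraNT yD; apply: D_G_posdef.
have z0 s : qform (invmx (D_L N)) s <= 0 -> s = 0.
  by rewrite leNgt => yD; apply/eqP; apply: contraNT yD; apply: pDi.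
have Dy1 := posdef_semi D_G_posdef y1; have Dy2 := posdef_semi D_G_posdef y2.
have Dz1 := posdef_semi pDi (TL^T *m F *m x1).
have Dz2 := posdef_semi pDi (TL^T *m F *m x2).
move=> m2 m1 f2 f1 bal.
have am1 := mulr_ge0 a0 m1; have am2 := mulr_ge0 a0 m2.
have af1 := mulr_ge0 a0 f1; have af2 := mulr_ge0 a0 f2.
have y10 : y1 = 0 by apply: y0; lra.
have y20 : y2 = 0 by apply: y0; lra.
have z10 : TL^T *m F *m x1 = 0 by apply: z0; lra.
have z20 : TL^T *m F *m x2 = 0 by apply: z0; lra.
have x0 (x : 'cV[R]_n.-1) : TL^T *m F *m x = 0 ->
    invmx (M_mx N) *m (TG^T *m F *m x) = 0 -> x = 0.
  move=> Lx Gx; have Fx : F *m x = 0.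
    apply: T_mx_tr_inj; rewrite mulmxA //.
    by rewrite -[LHS](mulKVmx (posdef_unit M_posdef)) Gx mulmx0.
  by rewrite -[x](mulKmx (posdef_unit pF)) Fx mulmx0.
move: J1 J2; rewrite !J_dynE y10 y20 !mulmx0 !scaler0 !addr0 !oppr0.
move=> /eq_col_mx[_ /eqP]; rewrite ?addr0 oppr_eq0 => /eqP G1.
move=> /eq_col_mx[_ /eqP]; rewrite ?addr0 oppr_eq0 => /eqP G2.
by move: nz; rewrite (x0 _ z10 G1) (x0 _ z20 G2) y10 y20 col_mx0 eqxx.
Qed.

(** An eigenvector for a real eigenvalue t is (T th, t th_G) where th is in the
    kernel of t^2 M + t D + L, the symmetric matrix of the linearized second-order
    equations of motion. If F is singular, t = 0 works; if its form takes a negative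
    value, so does that of L, and [singular_pencil] gives some t > 0. *)
Lemma not_posdef_unstable : ~ posdef F ->
  exists2 a, 0 <= a & (a%:C)%C \in eigenvalues J.
Proof.
move=> npF; have [Fu|Fu] := boolP (F \in unitmx); last first.
  have [x x0 Fx] := singular_kernelP _ Fu; exists 0 => //.
  apply: (@eigenvalues_real _ _ _ _ (col_mx x 0)).
    by rewrite J_dynE -!mulmxA Fx !mulmx0 !oppr0 !addr0 col_mx0 scale0r.
  by rewrite col_mx_eq0 eqxx andbT.
have [x xneg] : exists x, qform F x < 0.
  apply: contrapT => nneg; apply: npF => x x0.
  have psd : possemidef F.
    by move=> y; rewrite leNgt; apply/negP => yn; apply: nneg; exists y.
  have [c c0 /(_ x)] := coercive F_mx_sym psd Fu.
  by apply: lt_le_trans; rewrite mulr_gt0 // sqnorm_posdef.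
pose Mf : 'M[R]_n := diag_mx (row_mx (\row_i inertia N i) 0).
pose D : 'M[R]_n := diag_mx (row_mx (\row_i damping N (lshift d i))
                                    (\row_i damping N (rshift g i))).
have MfE : Mf = block_mx (M_mx N) 0 0 0 by rewrite /Mf diag_mx_row linear0.
have DE : D = block_mx (D_G N) 0 0 (D_L N) by rewrite /D diag_mx_row.
have pD : posdef D.
  apply: posdef_diag => i; case: (split_ordP i) => j ->.
    by rewrite row_mxEl mxE damping_gt0.
  by rewrite row_mxEr mxE damping_gt0.
have pM : possemidef Mf.
  move=> v; rewrite qform_diag sumr_ge0 // => i _; rewrite mulr_ge0 ?sqr_ge0 //.
  case: (split_ordP i) => j ->; first by rewrite row_mxEl mxE ltW // inertia_gt0.
  by rewrite row_mxEr mxE.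
have Lneg : qform L (E *m x) < 0 by rewrite -qform_congr -F_mxE.
have [||t [t0 [th th0]]] := singular_pencil (laplacian_sym N O theta) _ _ pD pM Lneg.
- by rewrite tr_diag_mx.
- by rewrite tr_diag_mx.
have [tG [tL thE]] : exists tG tL, th = col_mx tG tL.
  by exists (usubmx th), (dsubmx th); rewrite vsubmxK.
rewrite {th}thE in th0 *.
rewrite !mulmxDl -!scalemxAl laplacian_F_mx -!mulmxA MfE DE T_mxE tr_row_mx.
rewrite !mul_block_col !mul_row_col mul_col_mx !mul0mx !addr0 !add0r.
rewrite !scale_col_mx !add_col_mx scaler0 add0r -[RHS]col_mx0.
move=> /eq_col_mx[eqG eqL].
have Mu := posdef_unit M_posdef; have DLu := posdef_unit D_L_posdef.
exists t; first exact: ltW.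
apply: (@eigenvalues_real _ _ _ _ (col_mx (TG *m tG + TL *m tL) (t *: tG))).
  rewrite J_dynE scale_col_mx -!mulmxA.
  have -> : TL^T *m (F *m (TG *m tG + TL *m tL)) = - (t *: (D_L N *m tL)).
    by apply/eqP; rewrite -addr_eq0 addrC eqL.
  have -> : TG^T *m (F *m (TG *m tG + TL *m tL)) =
            - (t ^+ 2 *: (M_mx N *m tG) + t *: (D_G N *m tG)).
    by apply/eqP; rewrite -addr_eq0 addrC eqG.
  congr col_mx.
    by rewrite !mulmxN opprK -!scalemxAr mulKmx // scalerDr addrC.
  by rewrite !mulmxN opprK mulmxDr -!scalemxAr mulKmx // addrK scalerA expr2.
apply: contra_neq th0 => /eqP; rewrite col_mx_eq0 => /andP[/eqP x0 /eqP y0].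
have tG0 : tG = 0.
  by apply/eqP; move/eqP: y0; rewrite scaler_eq0 gt_eqF.
have tL0 : tL = 0.
  move: eqL; rewrite x0 !mulmx0 addr0 => /eqP.
  rewrite scaler_eq0 gt_eqF //= => /eqP DtL.
  by rewrite -[tL](mulKmx DLu) DtL mulmx0.
by rewrite tG0 tL0 col_mx0.
Qed.

Lemma stable_posdef : hyperbolic N O theta /\ locally_asymptotically_stable N O theta
  <-> posdef F.
Proof.
rewrite /hyperbolic /locally_asymptotically_stable hyperbolic_stableP.
split; last exact: posdef_stable.
move=> st; apply: contrapT => /not_posdef_unstable[a a0 /st /=].
by rewrite ltNge a0.
Qed.

End Linearization.

(** * Equivalence of stability and positive effective conductances *)

Theorem theorem9 (R : realType) (g d : nat) (N : power_network R g d)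
    (O : {set 'I_(g + d) * 'I_(g + d)}) (hO : is_orientation (line N) O)
    (alpha : 'cV[R]_(g + d).-1) (heq : is_equilibrium N alpha 0)
    (hw : forall i j, line N i j -> weight N (angle_of alpha) i j != 0) :
  let theta := angle_of alpha in
  let L := laplacian N O theta in
  let Vminus := neg_nodes N theta in
  let a := hyperbolic N O theta /\ locally_asymptotically_stable N O theta in
  let b := Vminus != finset.set0 ->
    exists U : nat -> {set 'I_(g + d)},
      sequential_inclusion Vminus U /\
      forall k, (1 <= k <= #|Vminus|.-1)%N ->
        geff_gt0 L (U k.+1 :\: U k)%SET (U k) in
  let c := forall Va Vb : {set 'I_(g + d)},
    Va != finset.set0 -> Vb != finset.set0 -> [disjoint Va & Vb] ->
    geff_gt0 L Va Vb in
  (a <-> b) /\ (b <-> c).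
Proof.
move=> theta L Vminus a b c.
have Ls : L^T = L by exact: laplacian_sym.
have L1 : L *m const_mx 1 = 0 :> 'cV[R]_(g + d) by exact: laplacian_const.
pose P := pos_nonconst L.
have aP : a <-> P by rewrite /a stable_posdef posdef_F_mx.
have Pc : P -> c.
  move=> pL A B A0 /set0Pn[v vB] dAB; apply: geff_gt0_of_posdef => //.
  apply: posdef_on_sub ((pos_nonconstP v Ls L1).2 pL).
  by rewrite finset.setCS finset.sub1set.
have cb : c -> b.
  move=> cL V0; exists (prefix_set Vminus).
  have sU := prefix_sequential_inclusion Vminus; split=> // k /andP[k1 kV].
  have kV' : (k < #|Vminus|)%N by rewrite (leq_ltn_trans kV) // ltn_predL card_gt0.
  have [sub card] := sU.1 k (introT andP (conj k1 kV')).
  apply: cL.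
  - by rewrite -card_gt0 cardsD (finset.setIidPr sub) card subSnn.
  - by rewrite -card_gt0 card_prefix_set // ltnW.
  - rewrite -finset.setI_eq0 finset.setDE -finset.setIA.
    by rewrite (finset.setIC (~: _)%SET) finset.setICr finset.setI0.
have bP : b -> P.
  move=> bL; have [V0|V0] := eqVneq Vminus finset.set0.
    apply/(pos_nonconstP (last_bus N) Ls L1); 
    apply: (posdef_on_nonneg_nodes hO hw (v := last_bus N)); last by rewrite !inE eqxx.
    by rewrite -/Vminus V0 -finset.setI_eq0 finset.setI0.
  have [U [sU gU]] := bL V0.
  apply: pos_nonconst_of_sequence sU _ gU => //.
  have /set0Pn[v vV] := V0.
  apply: (posdef_on_nonneg_nodes hO hw (v := v)); last by rewrite inE negbK.
  by rewrite -/Vminus -finset.setI_eq0 finset.setIC finset.setICr.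
by split; split; tauto.
Qed.
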